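(* Let $\mathcal{A}$ be a quasi-abelian category equipped with a rank function and a $\Lambda$-valued slope function $\mu$, where $\Lambda$ is a totally ordered, uniquely divisible abelian group. If $f: M \to N$ is a morphism in $W\mathcal{A}^{\mathrm{pre}}$ with $M \in W\mathcal{A}^{\mathrm{pre}}_{\mathrm{udq}}$ and $N \in W\mathcal{A}^{\mathrm{pre}}_{\mathrm{uds}}$, then $f$ is strictly compatible and strictly co-compatible with the filtrations.
   Context: All categories are essentially small. In an additive category with kernels and cokernels, put $\mathrm{Coim} f = \mathrm{Coker}(\ker f)$ and $\mathrm{Im} f = \mathrm{Ker}(\mathrm{coker} f)$; $f$ is strict if the canonical morphism $\mathrm{Coim} f \to \mathrm{Im} f$ is an isomorphism. Strict monics are exactly the kernels, strict epis exactly the cokernels. Subobject = monic, quotient = epi; they are called strict if the morphism is strict. A sequence $0 \to M \xrightarrow{f} N \xrightarrow{g} P \to 0$ is short exact if $f = \ker g$ and $g = \mathrm{coker} f$. A quasi-abelian category is an additive category with kernels and cokernels in which kernels are stable under pushout and cokernels are stable under pullback. For strict subobjects $A, B$ of $X$: $X/A$ is the cokernel of $A \hookrightarrow X$, $A \cap B$ is the pullback, $A + B$ is the image of $A \oplus B \to X$. For $f: M \to N$ and strict subobjects $P \hookrightarrow M$, $Q \hookrightarrow N$: $f(P) = \mathrm{Im}(P \hookrightarrow M \to N)$ and $f^{-1}(Q)$ is the pullback of $Q \hookrightarrow N$ along $f$. Slope functions. A rank function $\mathrm{rk}$ assigns to each isomorphism class of $\mathcal{A}$ a natural number, is additive along short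 exact sequences, and is nonzero on nonzero objects. A degree function $\deg$ assigns to each isomorphism class an element of $\Lambda$ and is additive along short exact sequences. $\mu = \deg/\mathrm{rk}$ (defined on nonzero objects) is a slope function if for every epi-monic $\varphi: M \to N$ in $\mathcal{A}$ one has $\mu(M) \leq \mu(N)$, with equality if and only if $\varphi$ is an isomorphism. Filtrations. $\mathrm{Fun}(\Lambda,\mathcal{A})$ is the category of functors from the totally ordered set $\Lambda$ to $\mathcal{A}$. $W\mathcal{A}^{\mathrm{pre}} \subset \mathrm{Fun}(\Lambda,\mathcal{A})$ is the full subcategory of finite ascending filtrations: functors $\lambda \mapsto W_{\leq\lambda}M$ with colimit $M$ such that each $W_{\leq\lambda}M \to M$ is a strict monic and there are finitely many breaks $\lambda_0 < \dots < \lambda_r$ such that $W_{\leq\lambda}M = 0$ for $\lambda < \lambda_0$, $W_{\leq\lambda}M = W_{\leq\lambda_{i-1}}M$ for $\lambda_{i-1} \leq \lambda < \lambda_i$, and $W_{\leq\lambda}M = M$ for $\lambda \geq \lambda_r$ (no breaks if $M=0$). Objects are written $(M,W)$ or $M$. Put $W_{<\lambda}M = \mathrm{colim}_{\lambda'<\lambda} W_{\leq\lambda'}M$ and $\mathrm{gr}^W_\lambda M = \mathrm{Coker}(W_{<\lambda}M \hookrightarrow W_{\leq\lambda}M)$. $W\mathcal{A}^{\mathrm{pre}}_{\mathrm{uds}} \subset W\mathcal{A}^{\mathrm{pre}}$ is the full subcategory of $(M,W)$ such that for all $\lambda \in \Lambda$, all nonzero subobjects of $\mathrm{gr}^W_\lambda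 M$ have slope $\leq \lambda$. $W\mathcal{A}^{\mathrm{pre}}_{\mathrm{udq}} \subset W\mathcal{A}^{\mathrm{pre}}$ is the full subcategory of $(M,W)$ such that for all $\lambda$, all nonzero quotients of $\mathrm{gr}^W_\lambda M$ have slope $\geq \lambda$. A morphism $f: M \to N$ in $W\mathcal{A}^{\mathrm{pre}}$ (with underlying morphism $f: M \to N$ in $\mathcal{A}$ on colimits) is strictly compatible with the filtrations if $f(W_{\leq\lambda}M) \hookrightarrow f(M) \cap W_{\leq\lambda}N$ is an isomorphism for all $\lambda$. It is strictly co-compatible with the filtrations if $(W_{\leq\lambda}M + \mathrm{Ker}_{\mathcal{A}} f)/\mathrm{Ker}_{\mathcal{A}} f \to f^{-1}(W_{\leq\lambda}N)/\mathrm{Ker}_{\mathcal{A}} f$ is an isomorphism for all $\lambda$. *)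

(* Defs.v *)
From HB Require Import structures.
From mathcomp Require Import all_boot all_order ssralg ssrnum.

Set Implicit Arguments.
Unset Strict Implicit.
Unset Printing Implicit Defensive.

Import Order.TTheory GRing.Theory Num.Theory.
Local Open Scope ring_scope.

(** * Totally ordered, uniquely divisible abelian groups *)

Record udivOrderedZmodType := UDivOrderedZmodType {
  ud_sort :> porderZmodType;
  ud_total : total (<=%R : rel ud_sort);
  ud_lerD2l : forall x y z : ud_sort, x <= y -> z + x <= z + y;
  ud_divisible : forall (x : ud_sort) (n : nat),
    (0 < n)%N -> exists! y : ud_sort, y *+ n = x
}.

Lemma ndiv_ex (L : udivOrderedZmodType) (x : L) (n : nat) :
  exists y : L, (0 < n)%N ==> (y *+ n == x).
Proof.
case: (posnP n) => [->|n_gt0]; first by exists 0.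
by have [y [yx _]] := ud_divisible x n_gt0; exists y; apply/eqP.
Qed.

(* The quotient x / n; a junk value for n = 0. *)
Definition ndiv (L : udivOrderedZmodType) (x : L) (n : nat) : L :=
  xchoose (ndiv_ex x n).

Lemma ndivK (L : udivOrderedZmodType) (x : L) (n : nat) :
  (0 < n)%N -> ndiv x n *+ n = x.
Proof. by move=> n_gt0; apply/eqP/(implyP (xchooseP (ndiv_ex x n))). Qed.

(** * Preadditive categories *)

(* Essential smallness is the universe level of obj. *)
Record preadditive := Preadditive {
  obj :> Type;
  hom : obj -> obj -> zmodType;
  idm : forall X, hom X X;
  mcomp : forall X Y Z, hom Y Z -> hom X Y -> hom X Z;
  mcompA : forall X Y Z T (h : hom Z T) (g : hom Y Z) (f : hom X Y),
    mcomp h (mcomp g f) = mcomp (mcomp h g) f;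
  mcomp1m : forall X Y (f : hom X Y), mcomp (idm Y) f = f;
  mcompm1 : forall X Y (f : hom X Y), mcomp f (idm X) = f;
  mcompDl : forall X Y Z (g h : hom Y Z) (f : hom X Y),
    mcomp (g + h) f = mcomp g f + mcomp h f;
  mcompDr : forall X Y Z (h : hom Y Z) (f g : hom X Y),
    mcomp h (f + g) = mcomp h f + mcomp h g
}.
Arguments hom {p} _ _.
Arguments idm {p} _.
Arguments mcomp {p X Y Z} _ _.

Notation "g \oc f" := (mcomp g f) (at level 40, left associativity).

Section Preadditive.
Variable C : preadditive.
Implicit Types X Y Z T : C.

Definition is_zero Z :=
  forall X, (exists! f : hom X Z, True) /\ (exists! f : hom Z X, True).

Definition monic X Y (f : hom X Y) :=
  forall T (g h : hom T X), f \oc g = f \oc h -> g = h.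

Definition epi X Y (f : hom X Y) :=
  forall T (g h : hom Y T), g \oc f = h \oc f -> g = h.

Definition iso X Y (f : hom X Y) :=
  exists g : hom Y X, g \oc f = idm X /\ f \oc g = idm Y.

Definition isomorphic X Y := exists f : hom X Y, iso f.

Definition is_kernel X Y K (f : hom X Y) (k : hom K X) :=
  f \oc k = 0 /\
  forall T (g : hom T X), f \oc g = 0 -> exists! h : hom T K, k \oc h = g.

Definition is_cokernel X Y Q (f : hom X Y) (q : hom Y Q) :=
  q \oc f = 0 /\
  forall T (g : hom Y T), g \oc f = 0 -> exists! h : hom Q T, h \oc q = g.

Definition is_biproduct X Y B (i1 : hom X B) (i2 : hom Y B)
    (p1 : hom B X) (p2 : hom B Y) :=
  [/\ p1 \oc i1 = idm X, p2 \oc i2 = idm Y, p1 \oc i2 = 0, p2 \oc i1 = 0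
    & i1 \oc p1 + i2 \oc p2 = idm B].

Definition is_pullback X Y Z P (f : hom X Z) (g : hom Y Z)
    (p1 : hom P X) (p2 : hom P Y) :=
  f \oc p1 = g \oc p2 /\
  forall T (a : hom T X) (b : hom T Y), f \oc a = g \oc b ->
    exists! h : hom T P, p1 \oc h = a /\ p2 \oc h = b.

Definition is_pushout X Y Z P (f : hom Z X) (g : hom Z Y)
    (i1 : hom X P) (i2 : hom Y P) :=
  i1 \oc f = i2 \oc g /\
  forall T (a : hom X T) (b : hom Y T), a \oc f = b \oc g ->
    exists! h : hom P T, h \oc i1 = a /\ h \oc i2 = b.

Definition short_exact X Y Z (f : hom X Y) (g : hom Y Z) :=
  is_kernel g f /\ is_cokernel f g.

Lemma mcomp0l X Y Z (f : hom X Y) : (0 : hom Y Z) \oc f = 0.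
Proof. by apply: (addrI ((0 : hom Y Z) \oc f)); rewrite -mcompDl !addr0. Qed.

Lemma mcompNl X Y Z (g : hom Y Z) (f : hom X Y) : (- g) \oc f = - (g \oc f).
Proof. by apply/eqP; rewrite -addr_eq0 -mcompDl addNr mcomp0l. Qed.

End Preadditive.

(** * Additive categories with kernels and cokernels; quasi-abelian categories *)

Record preabelian := Preabelian {
  pa_cat :> preadditive;
  zero_ex : exists Z : pa_cat, is_zero Z;
  bip : pa_cat -> pa_cat -> pa_cat;
  in1 : forall X Y, hom X (bip X Y);
  in2 : forall X Y, hom Y (bip X Y);
  pr1 : forall X Y, hom (bip X Y) X;
  pr2 : forall X Y, hom (bip X Y) Y;
  bipP : forall X Y, is_biproduct (in1 X Y) (in2 X Y) (pr1 X Y) (pr2 X Y);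
  Ker : forall X Y (f : hom X Y), pa_cat;
  ker : forall X Y (f : hom X Y), hom (Ker f) X;
  kerP : forall X Y (f : hom X Y), is_kernel f (ker f);
  Coker : forall X Y (f : hom X Y), pa_cat;
  coker : forall X Y (f : hom X Y), hom Y (Coker f);
  cokerP : forall X Y (f : hom X Y), is_cokernel f (coker f)
}.
Arguments bip {p} _ _.
Arguments in1 {p X Y}.
Arguments in2 {p X Y}.
Arguments pr1 {p X Y}.
Arguments pr2 {p X Y}.
Arguments Ker {p X Y} f.
Arguments ker {p X Y} f.
Arguments Coker {p X Y} f.
Arguments coker {p X Y} f.

Definition quasi_abelian (A : preabelian) : Prop :=
  (forall (X Y Z P W : A) (k : hom Z X) (w : hom X W) (g : hom Z Y)
      (i1 : hom X P) (i2 : hom Y P),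
    is_kernel w k -> is_pushout k g i1 i2 ->
    exists (V : A) (v : hom P V), is_kernel v i2) /\
  (forall (X Y Z P W : A) (q : hom X Z) (w : hom W X) (g : hom Y Z)
      (p1 : hom P X) (p2 : hom P Y),
    is_cokernel w q -> is_pullback q g p1 p2 ->
    exists (V : A) (v : hom V P), is_cokernel v p2).

Section Preabelian.
Variable A : preabelian.
Implicit Types X Y Z : A.

Definition Coim X Y (f : hom X Y) : A := Coker (ker f).
Definition coim X Y (f : hom X Y) : hom X (Coim f) := coker (ker f).
Definition Im X Y (f : hom X Y) : A := Ker (coker f).
Definition im X Y (f : hom X Y) : hom (Im f) Y := ker (coker f).

(* The canonical morphism is the unique c with im f . c . coim f = f. *)
Definition strict X Y (f : hom X Y) :=
  exists c : hom (Coim f) (Im f), im f \oc c \oc coim f = f /\ iso c.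

Definition strict_monic X Y (f : hom X Y) := monic f /\ strict f.

Definition pb_diff X Y Z (f : hom X Z) (g : hom Y Z) : hom (bip X Y) Z :=
  f \oc pr1 - g \oc pr2.
Definition Pb X Y Z (f : hom X Z) (g : hom Y Z) : A := Ker (pb_diff f g).
Definition pb1 X Y Z (f : hom X Z) (g : hom Y Z) : hom (Pb f g) X :=
  pr1 \oc ker (pb_diff f g).
Definition pb2 X Y Z (f : hom X Z) (g : hom Y Z) : hom (Pb f g) Y :=
  pr2 \oc ker (pb_diff f g).

Lemma PbP X Y Z (f : hom X Z) (g : hom Y Z) :
  is_pullback f g (pb1 f g) (pb2 f g).
Proof.
have [k0 kU] := kerP (pb_diff f g); have [p1i1 p2i2 p1i2 p2i1 ipE] := bipP X Y.
split.
  move: k0; rewrite /pb_diff mcompDl mcompNl -!mcompA => /eqP.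
  by rewrite subr_eq0 => /eqP.
move=> T a b fg; pose h : hom T (bip X Y) := in1 \oc a + in2 \oc b.
have h1 : pr1 \oc h = a.
  by rewrite /h mcompDr !mcompA p1i1 p1i2 mcomp1m mcomp0l addr0.
have h2 : pr2 \oc h = b.
  by rewrite /h mcompDr !mcompA p2i2 p2i1 mcomp1m mcomp0l add0r.
have [|u [uh uU]] := kU T h.
  by rewrite /pb_diff mcompDl mcompNl -!mcompA h1 h2 fg subrr.
exists u; split; first by rewrite /pb1 /pb2 -!mcompA uh.
move=> v [v1 v2]; apply: uU; rewrite /h -v1 -v2 /pb1 /pb2.
by rewrite -!mcompA !(mcompA in1) !(mcompA in2) -mcompDl ipE mcomp1m.
Qed.

(* For subobjects a : P -> X and b : Q -> X. *)
Definition cap X P Q (a : hom P X) (b : hom Q X) : hom (Pb a b) X :=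
  a \oc pb1 a b.
Definition sum_map X P Q (a : hom P X) (b : hom Q X) : hom (bip P Q) X :=
  a \oc pr1 + b \oc pr2.
Definition subsum X P Q (a : hom P X) (b : hom Q X) : hom (Im (sum_map a b)) X :=
  im (sum_map a b).

(* f(P) and f^-1(Q), for subobjects p : P -> X and q : Q -> Y. *)
Definition dirim X Y P (f : hom X Y) (p : hom P X) : hom (Im (f \oc p)) Y :=
  im (f \oc p).
Definition preim X Y Q (f : hom X Y) (q : hom Q Y) : hom (Pb f q) X :=
  pb1 f q.

(** * Rank, degree and slope *)

Record rank_function := RankFunction {
  rk :> A -> nat;
  rk_iso : forall X Y, isomorphic X Y -> rk X = rk Y;
  rk_add : forall X Y Z (f : hom X Y) (g : hom Y Z),
    short_exact f g -> rk Y = (rk X + rk Z)%N;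
  rk_neq0 : forall X, ~ is_zero X -> rk X <> 0%N
}.

Record degree_function (L : zmodType) := DegreeFunction {
  deg :> A -> L;
  deg_iso : forall X Y, isomorphic X Y -> deg X = deg Y;
  deg_add : forall X Y Z (f : hom X Y) (g : hom Y Z),
    short_exact f g -> deg Y = deg X + deg Z
}.

End Preabelian.

Section Slope.
Variables (L : udivOrderedZmodType) (A : preabelian).
Variables (r : rank_function A) (d : degree_function A L).

(* Only meaningful when X is nonzero. *)
Definition slope (X : A) : L := ndiv (d X) (r X).

Definition is_slope_function : Prop :=
  forall (X Y : A) (phi : hom X Y), ~ is_zero X -> ~ is_zero Y ->
    monic phi -> epi phi ->
    slope X <= slope Y /\ (slope X = slope Y <-> iso phi).

End Slope.

(** * Functors on a partially ordered set and their colimits *)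

Record pfunctor (d : Order.disp_t) (T : porderType d) (C : preadditive) :=
  PFunctor {
    fob :> T -> C;
    fmap : forall x y : T, (x <= y)%O -> hom (fob x) (fob y);
    fmap_id : forall x (h : (x <= x)%O), fmap h = idm (fob x);
    fmap_comp : forall x y z (h : (x <= y)%O) (k : (y <= z)%O)
        (l : (x <= z)%O), fmap l = fmap k \oc fmap h
  }.
Arguments fmap {d T C} _ {x y} _.

Record nat_trans (d : Order.disp_t) (T : porderType d) (C : preadditive)
    (F G : pfunctor T C) := NatTrans {
  nt :> forall x, hom (F x) (G x);
  nt_natural : forall x y (h : (x <= y)%O), nt y \oc fmap F h = fmap G h \oc nt x
}.

Section Colimit.
Variables (d : Order.disp_t) (T : porderType d) (C : preadditive).
Variable F : pfunctor T C.

Definition is_cocone (X : C) (c : forall x, hom (F x) X) :=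
  forall x y (h : (x <= y)%O), c y \oc fmap F h = c x.

Definition is_colimit (X : C) (c : forall x, hom (F x) X) :=
  is_cocone c /\
  forall (Y : C) (e : forall x, hom (F x) Y), is_cocone e ->
    exists! u : hom X Y, forall x, u \oc c x = e x.

End Colimit.

Definition below (L : udivOrderedZmodType) (l : L) := {x : L | x < l}.
HB.instance Definition _ (L : udivOrderedZmodType) (l : L) :=
  SubChoice.on (below l).
HB.instance Definition _ (L : udivOrderedZmodType) (l : L) :=
  [SubChoice_isSubPOrder of below l by <: with ring_display].

Section Below.
Variables (L : udivOrderedZmodType) (C : preadditive) (F : pfunctor L C).
Variable l : L.

Definition restr_fmap (x y : below l) (h : (x <= y)%O) :
    hom (F (\val x)) (F (\val y)) := fmap F (h : \val x <= \val y).

Lemma restr_fmap_id (x : below l) (h : (x <= x)%O) :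
  restr_fmap h = idm (F (\val x)).
Proof. exact: fmap_id. Qed.

Lemma restr_fmap_comp (x y z : below l) (h : (x <= y)%O) (k : (y <= z)%O)
    (m : (x <= z)%O) : restr_fmap m = restr_fmap k \oc restr_fmap h.
Proof. exact: fmap_comp. Qed.

Definition restr : pfunctor (below l) C :=
  PFunctor restr_fmap_id restr_fmap_comp.

End Below.

(** * Finite ascending filtrations *)

Section Filtration.
Variables (L : udivOrderedZmodType) (A : preabelian).

(* s is the increasing sequence of breaks of the functor W with colimit X. *)
Definition is_breaks (W : pfunctor L A) (X : A) (inc : forall l, hom (W l) X)
    (s : seq L) :=
  [/\ sorted <%R s,
      s = [::] <-> is_zero X,
      forall l, s <> [::] -> l < head 0 s -> is_zero (W l),
      forall (i : nat) (l : L) (h : s`_i <= l),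
        (i.+1 < size s)%N -> l < s`_i.+1 -> iso (fmap W h)
    & forall l, s <> [::] -> last 0 s <= l -> iso (inc l)].

Record filtration := Filtration {
  fil :> pfunctor L A;
  tot : A;
  inc : forall l, hom (fil l) tot;
  inc_colimit : is_colimit inc;
  inc_strict : forall l, strict_monic (inc l);
  fil_finite : exists s : seq L, is_breaks inc s
}.

(* ftot is the map induced by the natural transformation on colimits; it is
   determined by ftot_inc. *)
Record filtration_hom (M N : filtration) := FiltrationHom {
  fnt :> nat_trans M N;
  ftot : hom (tot M) (tot N);
  ftot_inc : forall l, ftot \oc inc M l = inc N l \oc fnt l
}.

(* G is a cokernel of the canonical map i : W_{<l} M -> W_{<=l} M, where W_{<l} M
   is a colimit of the W_{<=x} M, x < l; so G is determined up to isomorphism. *)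
Definition is_gr (M : filtration) (l : L) (G : A) :=
  exists (B : A) (c : forall x : below l, hom (restr M l x) B)
         (i : hom B (M l)) (q : hom (M l) G),
    [/\ is_colimit c,
        forall x : below l, i \oc c x = fmap M (ltW (valP x))
      & is_cokernel i q].

Variables (r : rank_function A) (d : degree_function A L).

Definition uds (M : filtration) :=
  forall (l : L) (G : A), is_gr M l G ->
  forall (S : A) (m : hom S G), monic m -> ~ is_zero S -> slope r d S <= l.

Definition udq (M : filtration) :=
  forall (l : L) (G : A), is_gr M l G ->
  forall (Q : A) (q : hom G Q), epi q -> ~ is_zero Q -> l <= slope r d Q.

End Filtration.

(* Graded pieces exist, so uds and udq are never vacuous. *)
Section GrExists.
Variables (L : udivOrderedZmodType) (A : preabelian) (M : filtration L A).

Lemma zero_in (Z X : A) (f g : hom X Z) : is_zero Z -> f = g.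
Proof. by move=> /(_ X)[[h [_ hU]] _]; rewrite -(hU f I) -(hU g I). Qed.

Lemma zero_out (Z X : A) (f g : hom Z X) : is_zero Z -> f = g.
Proof. by move=> /(_ X)[_ [h [_ hU]]]; rewrite -(hU f I) -(hU g I). Qed.

Lemma inc_monic l : monic (inc M l). Proof. by have [] := inc_strict M l. Qed.

Lemma inc_fmap x y (h : x <= y) : inc M y \oc fmap M h = inc M x.
Proof. by have [c _] := inc_colimit M; exact: c. Qed.

Lemma ud_leNgt (x y : L) : ~~ (x < y) -> y <= x.
Proof.
move=> xy; have /orP[//|] := ud_total y x.
by rewrite le_eqVlt (negPf xy) orbF => /eqP->.
Qed.

Lemma colim_zero l : (forall x, x < l -> is_zero (M x)) ->
  exists (B : A) (c : forall x : below l, hom (restr M l x) B), is_colimit c.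
Proof.
move=> M0; have [B B0] := zero_ex A.
exists B, (fun=> 0); split=> [x y h|Y e _]; first exact: zero_in.
have [_ [u _]] := B0 Y; exists u; split=> [x|v _]; last exact: zero_out.
by apply/zero_out/M0/(valP x).
Qed.

Lemma colim_const l b : b < l ->
  (forall x (h : b <= x), x < l -> iso (fmap M h)) ->
  exists (B : A) (c : forall x : below l, hom (restr M l x) B), is_colimit c.
Proof.
move=> bl bI.
have cex (x : below l) : exists h : hom (M (val x)) (M b),
    inc M b \oc h == inc M (val x).
  have /orP[xb|bx] := ud_total (val x) b.
    by exists (fmap M xb); rewrite inc_fmap.
  have [g [gf fg]] := bI _ bx (valP x); exists g.
  by rewrite -(inc_fmap bx) -mcompA fg mcompm1.
pose c (x : below l) : hom (restr M l x) (M b) := xchoose (cex x).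
have cE (x : below l) : inc M b \oc c x = inc M (val x).
  exact/eqP/(xchooseP (cex x)).
exists (M b), c; split=> [x y h|Y e eC].
  by apply: inc_monic; rewrite mcompA !cE /restr /= /restr_fmap inc_fmap.
pose b' : below l := Sub b bl.
exists (e b'); split=> [x|v /(_ b')].
  have /orP[xb|bx] := ud_total (val x) b.
    rewrite -(eC x b' xb); congr (_ \oc _); apply: inc_monic.
    exact: etrans (cE x) (esym (inc_fmap _)).
  rewrite -(eC b' x bx) -mcompA -[RHS]mcompm1; congr (_ \oc _).
  apply: inc_monic; rewrite mcompA mcompm1.
  by rewrite [X in X \oc _](inc_fmap (bx : b <= val x)); exact: cE.
move=> <-; rewrite -[RHS]mcompm1; congr (_ \oc _); apply: inc_monic.
exact: etrans (cE b') (esym (mcompm1 _)).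
Qed.

Lemma gr_ex l : exists G, is_gr M l G.
Proof.
suff [B [c cC]] : exists (B : A) (c : forall x : below l, hom (restr M l x) B),
    is_colimit c.
  have [|i [iE _]] := cC.2 (M l) (fun x => fmap M (ltW (valP x))).
    by move=> x y h; rewrite /restr /= /restr_fmap -(fmap_comp _ _ _ (ltW (valP x))).
  exists (Coker i), B, c, i, (coker i); split=> //; exact: cokerP.
have [s [ss s0 s1 s2 s3]] := fil_finite M.
case: s ss s0 s1 s2 s3 => [|b0 s] ss s0 s1 s2 s3.
  have t0 := s0.1 erefl.
  apply: colim_zero => x _ X.
  have eq0 : idm (M x) = 0 by apply: inc_monic; exact: zero_in.
  split; exists 0; split=> // g _; first by apply: inc_monic; exact: zero_in.
  by rewrite -[g]mcompm1 eq0; apply: (addrI (g \oc 0)); rewrite -mcompDr !addr0.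
case: (boolP (b0 < l)) => [b0l|b0l]; last first.
  apply: colim_zero => x xl; apply: s1 => //=; apply: lt_le_trans xl _.
  exact: ud_leNgt.
have exi : exists i, (i < size (b0 :: s))%N && ((b0 :: s)`_i < l) by exists 0%N.
have ubi i : (i < size (b0 :: s))%N && ((b0 :: s)`_i < l) -> (i <= size s)%N.
  by case/andP.
case: (ex_maxnP exi ubi) => i /andP[i_s il] imax.
apply: (colim_const il) => x h xl.
case: (ltnP i.+1 (size (b0 :: s))) => [i1s | si1].
  apply: s2 => //; apply: lt_le_trans xl _.
  apply: ud_leNgt; apply/negP => lt.
  by have := imax i.+1; rewrite i1s lt ltnn => /(_ isT).
have iE : (b0 :: s)`_i = last 0 (b0 :: s).
  have -> : i = size s by apply/eqP; rewrite eqn_leq; apply/andP; split.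
  exact: (nth_last 0 (b0 :: s)).
have nn : b0 :: s <> [::] by [].
have [u [u1 u2]] : iso (inc M ((b0 :: s)`_i)).
  by apply: (s3 _ nn); rewrite iE lexx.
have [v [v1 v2]] : iso (inc M x) by apply: (s3 _ nn); rewrite -iE.
exists (u \oc inc M x); split; first by rewrite -mcompA inc_fmap.
by apply: inc_monic; rewrite !mcompA inc_fmap u2 mcomp1m mcompm1.
Qed.
End GrExists.

Section Strictness.
Variables (L : udivOrderedZmodType) (A : preabelian).
Variables (M N : filtration L A) (f : filtration_hom M N).

(* u is the inclusion of subobjects of N, unique since the right-hand one is
   monic. *)
Definition strictly_compatible :=
  forall l : L,
  exists u : hom (Im (ftot f \oc inc M l)) (Pb (im (ftot f)) (inc N l)),
    cap (im (ftot f)) (inc N l) \oc u = dirim (ftot f) (inc M l) /\ iso u.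

(* a and b are the inclusions of Ker f in W_{<=l} M + Ker f and in the preimage
   of W_{<=l} N, and j is the inclusion of the former in the latter; these are
   unique, and u is the map induced by j on the quotients by Ker f. *)
Definition strictly_cocompatible :=
  forall l : L,
  let s := subsum (inc M l) (ker (ftot f)) in
  let t := preim (ftot f) (inc N l) in
  exists (a : hom (Ker (ftot f)) (Im (sum_map (inc M l) (ker (ftot f)))))
         (b : hom (Ker (ftot f)) (Pb (ftot f) (inc N l)))
         (j : hom (Im (sum_map (inc M l) (ker (ftot f))))
                  (Pb (ftot f) (inc N l)))
         (u : hom (Coker a) (Coker b)),
    [/\ s \oc a = ker (ftot f), t \oc b = ker (ftot f), t \oc j = s,
        u \oc coker a = coker b \oc j & iso u].

End Strictness.

(* Main.v *)
(* Factor the underlying morphism of f as j p with p : M -> X epi and j : X -> N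
   monic. On the same object X there are two strict filtrations: the images P_l
   of W_{<=l} M and the larger pullbacks Q_l of W_{<=l} N. The graded pieces of P
   are epi-quotients of those of M, so their slopes are >= l; the graded pieces
   of Q embed in those of N, so their slopes are <= l. Hence, along the common
   breaks a < b, the quantities E_l = l rk(Q_l / P_l) - deg(Q_l / P_l) satisfy
   E_b >= E_a + (b - a) rk(Q_a / P_a). As E is nonnegative at the first break
   and zero at the last one, every rk(Q_l / P_l) vanishes and P = Q. Taking
   X = Im f gives strict compatibility, X = Coim f strict co-compatibility.
   Since both filtrations live on one object, ranks of strict subquotients
   suffice: rk need not be invariant under epi-monics. *)

Require Import Defs.
From mathcomp Require Import all_boot all_order ssralg ssrnum.

Set Implicit Arguments.
Unset Strict Implicit.
Unset Printing Implicit Defensive.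

Import Order.TTheory GRing.Theory.
Local Open Scope ring_scope.

(** * Inequalities in the ordered group and a telescoping argument along a list *)

Section OrderedGroup.
Variable L : udivOrderedZmodType.
Implicit Types (x y z t : L) (s : seq L).

Lemma ud_ltNge x y : ~~ (x <= y) -> y < x.
Proof.
move=> xy; rewrite lt_neqAle; case: eqVneq => [yx | _] /=.
  by rewrite yx lexx in xy.
by have := ud_total x y; rewrite (negPf xy).
Qed.

Lemma ud_lerD x y z t : x <= y -> z <= t -> x + z <= y + t.
Proof.
move=> xy zt; apply: le_trans (ud_lerD2l x zt) _.
by rewrite ![_ + t]addrC ud_lerD2l.
Qed.

Lemma ud_subr_ge0 x y : (0 <= y - x) = (x <= y).
Proof.
apply/idP/idP => xy; first by have := ud_lerD2l x xy; rewrite addr0 subrKC.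
by have := ud_lerD2l (- x) xy; rewrite addNr addrC.
Qed.

Lemma ud_lerMn x y n : x <= y -> x *+ n <= y *+ n.
Proof.
by move=> xy; elim: n => [|n IH]; rewrite ?mulr0n // !mulrS ud_lerD.
Qed.

Lemma ud_mulrn_le0 x n : 0 < x -> x *+ n <= 0 -> n = 0%N.
Proof.
case: n => // n x_gt0; rewrite mulrS => xn.
have xn0 : 0 <= x *+ n by have := ud_lerMn n (ltW x_gt0); rewrite mul0rn.
have := ud_lerD2l x xn0; rewrite addr0 => /le_trans/(_ xn) x_le0.
by have := lt_le_trans x_gt0 x_le0; rewrite ltxx.
Qed.

(** Neighbours are characterised by order alone, the form in which the absence of a break between
    two values is used. Indexing by a strictly increasing [nth] shows that an entry below the one at
    index i + 1 has index at most i. *)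
Lemma path_consecutive (e : rel L) a s :
  path <%R a s ->
  (forall x y, x \in a :: s -> y \in a :: s -> x < y ->
    (forall c, c \in a :: s -> c < y -> c <= x) -> e x y) ->
  path e a s.
Proof.
move=> a_s eP; apply/(pathP a) => i i_s.
have mono := lt_sorted_ltn_nth a (a_s : sorted <%R (a :: s)).
have i_as : (i < size (a :: s))%N by rewrite /= ltnS ltnW.
have Si_as : (i.+1 < size (a :: s))%N by [].
apply: eP; first exact: mem_nth.
- exact: (mem_nth a Si_as).
- by have := mono i i.+1 i_as Si_as; rewrite ltnSn.
move=> c /(nthP a)[k k_as <-] kSi.
have := mono k i.+1 k_as Si_as; rewrite [in LHS]/= kSi => /esym.
rewrite ltnS leq_eqVlt => /orP[/eqP-> // | ki].
by apply: ltW; rewrite mono.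
Qed.

(** Each step raises E by at least a nonnegative amount, so E is squeezed between 0 at the head and
    0 at the end. Every increment (y - x) R(x) is then at most 0, and y - x > 0 forces R(x) = 0. *)
Lemma path_defect_eq0 (E : L -> L) (R : L -> nat) a s :
  path [rel x y | (x < y) && (E x + (y - x) *+ R x <= E y)] a s ->
  0 <= E a -> E (last a s) <= 0 -> R (last a s) = 0%N ->
  forall x, x \in a :: s -> R x = 0%N.
Proof.
move=> pas Ea0 El0 Rl0.
(* The extra bound on E a lets the induction carry the upper bound from the last entry back to the
   head. *)
suff [_ //] : E a <= 0 /\ forall x, x \in a :: s -> R x = 0%N.
elim: s a pas Ea0 El0 Rl0 => [|b s IH] a /= pas Ea0 El0 Rl0.
  by split=> // x; rewrite inE => /eqP->.
have /andP[/andP[ab Eab] pbs] := pas.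
have ba0 : 0 <= (b - a) *+ R a.
  by have := ud_lerMn (R a) (ltW ab); rewrite mulrnBl ud_subr_ge0.
have Eb0 : 0 <= E b.
  by apply: le_trans Eab; have := ud_lerD Ea0 ba0; rewrite addr0.
have [Eb0' Rs] := IH b pbs Eb0 El0 Rl0.
have Eab0 := le_trans Eab Eb0'.
have Ea0' : E a <= 0.
  by apply: le_trans Eab0; have := ud_lerD2l (E a) ba0; rewrite addr0.
split=> // x; rewrite inE => /orP[/eqP-> | /Rs //].
apply: (@ud_mulrn_le0 (b - a)).
  by rewrite lt_neqAle ud_subr_ge0 ltW // andbT eq_sym subr_eq0 gt_eqF.
apply: le_trans Eab0.
by have := ud_lerD Ea0 (lexx ((b - a) *+ R a)); rewrite add0r.
Qed.

End OrderedGroup.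

(** * Monics, epis, kernels and cokernels in preadditive categories *)

Section PreadditiveTheory.
Variable C : preadditive.
Implicit Types X Y Z T K Q : C.

Lemma mcomp0r X Y Z (f : hom Y Z) : f \oc (0 : hom X Y) = 0.
Proof. by apply: (addrI (f \oc 0)); rewrite -mcompDr !addr0. Qed.

Lemma mcompNr X Y Z (g : hom Y Z) (f : hom X Y) : g \oc (- f) = - (g \oc f).
Proof. by apply/eqP; rewrite -addr_eq0 -mcompDr addNr mcomp0r. Qed.

Lemma monic0 X Y (f : hom X Y) :
  (forall T (g : hom T X), f \oc g = 0 -> g = 0) -> monic f.
Proof.
move=> f0 T g h fgh; apply/eqP; rewrite -subr_eq0; apply/eqP/f0.
by rewrite mcompDr mcompNr fgh subrr.
Qed.

Lemma epi0 X Y (f : hom X Y) :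
  (forall T (g : hom Y T), g \oc f = 0 -> g = 0) -> epi f.
Proof.
move=> f0 T g h fgh; apply/eqP; rewrite -subr_eq0; apply/eqP/f0.
by rewrite mcompDl mcompNl fgh subrr.
Qed.

Lemma monic_eq0 X Y (f : hom X Y) T (g : hom T X) :
  monic f -> f \oc g = 0 -> g = 0.
Proof. by move=> f_mono fg; apply: f_mono; rewrite fg mcomp0r. Qed.

Lemma epi_eq0 X Y (f : hom X Y) T (g : hom Y T) : epi f -> g \oc f = 0 -> g = 0.
Proof. by move=> f_epi gf; apply: f_epi; rewrite gf mcomp0l. Qed.

Lemma kernel_monic X Y K (f : hom X Y) (k : hom K X) : is_kernel f k -> monic k.
Proof.
move=> [fk kU]; apply: monic0 => T g kg.
have [|h [_ hU]] := kU T 0; first by rewrite mcomp0r.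
by rewrite -(hU g kg); apply: hU; rewrite mcomp0r.
Qed.

Lemma cokernel_epi X Y Q (f : hom X Y) (q : hom Y Q) : is_cokernel f q -> epi q.
Proof.
move=> [qf qU]; apply: epi0 => T g gq.
have [|h [_ hU]] := qU T 0; first by rewrite mcomp0l.
by rewrite -(hU g gq); apply: hU; rewrite mcomp0l.
Qed.

Lemma epi_compr X Y Z (g : hom Y Z) (f : hom X Y) : epi (g \oc f) -> epi g.
Proof.
move=> gf_epi; apply: epi0 => T h hg; apply: (epi_eq0 gf_epi).
by rewrite mcompA hg mcomp0l.
Qed.

Lemma epi_comp X Y Z (g : hom Y Z) (f : hom X Y) :
  epi g -> epi f -> epi (g \oc f).
Proof.
move=> g_epi f_epi; apply: epi0 => T h; rewrite mcompA => hgf.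
exact/(epi_eq0 g_epi)/(epi_eq0 f_epi).
Qed.

Lemma monic_compr X Y Z (g : hom Y Z) (f : hom X Y) :
  monic (g \oc f) -> monic f.
Proof.
move=> gf_mono; apply: monic0 => T h hg; apply: (monic_eq0 gf_mono).
by rewrite -mcompA hg mcomp0r.
Qed.

Lemma iso_epi X Y (f : hom X Y) : iso f -> epi f.
Proof.
move=> [g [_ fg]]; apply: epi0 => T h hf.
by rewrite -[h]mcompm1 -fg mcompA hf mcomp0l.
Qed.

Lemma iso_cancell X Y Z (g : hom Y Z) (f : hom X Y) :
  iso g -> iso (g \oc f) -> iso f.
Proof.
move=> [h [hg gh]] [k [kgf gfk]]; exists (k \oc g); split.
  by rewrite -mcompA.
suff fk : f \oc k = h by rewrite mcompA fk hg.
by rewrite -[f]mcomp1m -hg -!mcompA (mcompA g) gfk mcompm1.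
Qed.

Lemma iso_cancelr X Y Z (g : hom Y Z) (f : hom X Y) :
  iso f -> iso (g \oc f) -> iso g.
Proof.
move=> [h [hf fh]] [k [kgf gfk]]; exists (f \oc k).
split; last by rewrite mcompA.
suff kg : k \oc g = h by rewrite -mcompA kg fh.
by rewrite -[g]mcompm1 -fh (mcompA g) mcompA kgf mcomp1m.
Qed.

Lemma idm0_is_zero X : idm X = 0 -> is_zero X.
Proof.
move=> X0 Y; split; exists 0; split=> // g _.
  by rewrite -[g]mcomp1m X0 mcomp0l.
by rewrite -[g]mcompm1 X0 mcomp0r.
Qed.

Lemma is_zero_idm X : is_zero X -> idm X = 0.
Proof. by move=> /(_ X)[[h [_ hU]] _]; rewrite -(hU (idm X) I) -(hU 0 I). Qed.

Lemma kernel_of_cokernel X Y K Q (w : hom X Y) (k : hom K X) (q : hom X Q) :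
  is_kernel w k -> is_cokernel k q -> is_kernel q k.
Proof.
move=> [wk kU] [qk qU]; split=> // T g qg; apply: kU.
by have [v [<- _]] := qU _ _ wk; rewrite -mcompA qg mcomp0r.
Qed.

Lemma kernel_pullback X Y Z W (f : hom X Z) (k : hom Y Z) (w : hom Z W) P
    (p1 : hom P X) (p2 : hom P Y) :
  is_kernel w k -> is_pullback f k p1 p2 -> is_kernel (w \oc f) p1.
Proof.
move=> kK [pE pU]; have k_mono := kernel_monic kK; case: kK => wk kU.
split=> [|T g]; first by rewrite -mcompA pE mcompA wk mcomp0l.
rewrite -mcompA => /kU[h [kh _]].
have [u [[u1 u2] uU]] := pU T g h (esym kh).
exists u; split=> // v v1; apply: uU; split=> //.
by apply: k_mono; rewrite mcompA -pE -mcompA v1 kh.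
Qed.

End PreadditiveTheory.

(** * Images, coimages and strict subobjects in quasi-abelian categories *)

Section QuasiAbelian.
Variable A : preabelian.
Hypothesis A_qa : quasi_abelian A.
Implicit Types X Y Z T K Q : A.

Lemma pushout_ex X Y Z (f : hom Z X) (g : hom Z Y) :
  exists (P : A) (i1 : hom X P) (i2 : hom Y P), is_pushout f g i1 i2.
Proof.
have [p1i1 p2i2 p1i2 p2i1 ipE] := bipP X Y.
pose m : hom Z (bip X Y) := in1 \oc f - in2 \oc g.
have [c0 cU] := cokerP m.
exists (Coker m), (coker m \oc in1), (coker m \oc in2); split.
  apply/eqP; rewrite -subr_eq0 -!mcompA -mcompNr -mcompDr; exact/eqP.
move=> T a b ab; pose h := a \oc pr1 + b \oc pr2 : hom (bip X Y) T.
have h1 : h \oc in1 = a.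
  by rewrite /h mcompDl -!mcompA p1i1 p2i1 mcompm1 mcomp0r addr0.
have h2 : h \oc in2 = b.
  by rewrite /h mcompDl -!mcompA p1i2 p2i2 mcompm1 mcomp0r add0r.
have [|u [uh uU]] := cU T h.
  by rewrite /m mcompDr mcompNr !mcompA h1 h2 ab subrr.
exists u; split; first by rewrite !mcompA uh.
move=> v [v1 v2]; apply: uU; rewrite /h -v1 -v2 -!mcompA -!mcompDr.
by rewrite ipE mcompm1.
Qed.

(** If m x = 0, pull the cokernel q back along x: the projection to T is again a cokernel, hence
    epi. The other projection is killed by f, so it factors through k and q kills it; thus x
    vanishes after an epi. *)
Lemma coimage_monic X Y K Q (f : hom X Y) (k : hom K X) (q : hom X Q)
    (m : hom Q Y) :
  is_kernel f k -> is_cokernel k q -> m \oc q = f -> monic m.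
Proof.
move=> [_ kU] qC mq; apply: monic0 => T x mx.
have xP := PbP q x.
have [V [v vC]] := A_qa.2 _ _ _ _ _ _ _ _ _ _ qC xP.
apply: (epi_eq0 (cokernel_epi vC)); rewrite -xP.1.
have [|y [<- _]] := kU _ (pb1 q x).
  by rewrite -mq -mcompA xP.1 mcompA mx mcomp0l.
by rewrite mcompA qC.1 mcomp0l.
Qed.

(** Dual to [coimage_monic], with the pushout of the kernel k along y. *)
Lemma image_epi X Y K Q (f : hom X Y) (c : hom Y Q) (k : hom K Y)
    (e : hom X K) :
  is_cokernel f c -> is_kernel c k -> k \oc e = f -> epi e.
Proof.
move=> [_ cU] kK ke; apply: epi0 => T y ye.
have [P [i1 [i2 iP]]] := pushout_ex k y.
have [V [v vK]] := A_qa.1 _ _ _ _ _ _ _ _ _ _ kK iP.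
apply: (monic_eq0 (kernel_monic vK)); rewrite -iP.1.
have [|z [<- _]] := cU _ i1.
  by rewrite -ke mcompA iP.1 -mcompA ye mcomp0r.
by rewrite -mcompA kK.1 mcomp0r.
Qed.

Lemma image_factor X Y (f : hom X Y) :
  exists e : hom X (Im f), im f \oc e = f /\ epi e.
Proof.
have [e [ef _]] := (kerP (coker f)).2 _ _ (cokerP f).1.
by exists e; split=> //; apply: image_epi (cokerP f) (kerP (coker f)) ef.
Qed.

Lemma coimage_factor X Y (f : hom X Y) :
  exists m : hom (Coim f) Y, m \oc coim f = f /\ monic m.
Proof.
have [m [mf _]] := (cokerP (ker f)).2 _ _ (kerP f).1.
by exists m; split=> //; apply: coimage_monic (kerP f) (cokerP (ker f)) mf.
Qed.

Lemma im_kernel X Y K W (f : hom X Y) (w : hom Y W) (k : hom K Y)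
    (e : hom X K) :
  is_kernel w k -> k \oc e = f ->
  exists u : hom (Im f) K, k \oc u = im f.
Proof.
move=> [wk kU] kef; have [|v [vc _]] := (cokerP f).2 _ w.
  by rewrite -kef mcompA wk mcomp0l.
have [|u [ku _]] := kU _ (im f); last by exists u.
by rewrite -vc -mcompA (kerP (coker f)).1 mcomp0r.
Qed.

(** As e is epi, [coker f] kills k, so k factors through [im f]; [im_kernel] gives the opposite
    factorization. *)
Lemma im_kernel_iso X Y K W (f : hom X Y) (w : hom Y W) (k : hom K Y)
    (e : hom X K) :
  is_kernel w k -> k \oc e = f -> epi e ->
  exists u : hom (Im f) K, k \oc u = im f /\ iso u.
Proof.
move=> kK kef e_epi; have [u ku] := im_kernel kK kef; exists u; split=> //.
have [|x [kx _]] := (kerP (coker f)).2 _ k.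
  by apply: (epi_eq0 e_epi); rewrite -mcompA kef (cokerP f).1.
exists x; split.
  by apply: (kernel_monic (kerP (coker f))); rewrite mcompA kx ku mcompm1.
by apply: (kernel_monic kK); rewrite mcompA ku kx mcompm1.
Qed.

(** A monic f has zero kernel, so [coim f] is invertible; by strictness f then agrees with the
    kernel [im f] up to an isomorphism of sources. *)
Lemma strict_monic_kernel X Y (f : hom X Y) :
  strict_monic f -> is_kernel (coker f) f.
Proof.
move=> [f_mono [c [fE [c' [c'c cc']]]]]; split=> [|T g].
  exact: (cokerP f).1.
move=> /(kerP (coker f)).2[y [yg _]].
have kf0 : ker f = 0 by apply: (monic_eq0 f_mono); exact: (kerP f).1.
have [|h [hE _]] := (cokerP (ker f)).2 _ (idm X); first by rewrite kf0 mcomp0r.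
have coimh : coim f \oc h = idm (Coim f).
  by apply: (cokernel_epi (cokerP (ker f))); rewrite -mcompA hE mcompm1 mcomp1m.
have fg : f \oc (h \oc c' \oc y) = g.
  transitivity (im f \oc c \oc coim f \oc (h \oc c' \oc y)).
    by rewrite fE.
  rewrite !mcompA -(mcompA _ (coim f)) coimh mcompm1 -(mcompA _ c) cc'.
  by rewrite mcompm1 -yg.
by exists (h \oc c' \oc y); split=> // v fv; apply: f_mono; rewrite fg fv.
Qed.

Lemma coker_zero_epi X Y (f : hom X Y) : is_zero (Coker f) -> epi f.
Proof.
move=> f0; apply: epi0 => T g /(cokerP f).2[h [<- _]].
by rewrite -[h]mcompm1 is_zero_idm // mcomp0r mcomp0l.
Qed.

Lemma im0_is_zero X Y : is_zero (Im (0 : hom X Y)).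
Proof.
have [|h [hc _]] := (cokerP (0 : hom X Y)).2 _ (idm Y).
  by rewrite mcomp0r.
apply/idm0_is_zero/(monic_eq0 (kernel_monic (kerP (coker (0 : hom X Y))))).
by rewrite mcompm1 -[ker _]mcomp1m -hc -mcompA (kerP (coker _)).1 mcomp0r.
Qed.

Lemma pb_joint X Y Z (f : hom X Z) (g : hom Y Z) T (u v : hom T (Pb f g)) :
  pb1 f g \oc u = pb1 f g \oc v -> pb2 f g \oc u = pb2 f g \oc v -> u = v.
Proof.
move=> uv1 uv2; have [pE pU] := PbP f g.
have [|w [_ wU]] := pU T (pb1 f g \oc v) (pb2 f g \oc v).
  by rewrite mcompA pE -mcompA.
by rewrite -(wU u) // -(wU v).
Qed.

Lemma pb0_is_zero X Y Z (f : hom X Z) :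
  monic f -> is_zero Y -> is_zero (Pb f (0 : hom Y Z)).
Proof.
move=> f_mono Y0; apply: idm0_is_zero; apply: pb_joint; rewrite mcompm1 mcomp0r.
  by apply: (monic_eq0 f_mono); rewrite (PbP f _).1 mcomp0l.
by rewrite -[pb2 _ _]mcomp1m is_zero_idm // mcomp0l.
Qed.


(** Makes the graded pieces of the image filtration epi-quotients of those of M: the map from Y to
    Im g / Im(g i) is epi and kills i, so it factors through q by an epi. *)
Lemma im_comp_quotient B X Y G (g : hom Y X) (i : hom B Y) (q : hom Y G) :
  is_cokernel i q ->
  exists (Q : A) (v : hom (Im (g \oc i)) (Im g)) (c : hom (Im g) Q)
         (h : hom G Q), short_exact v c /\ epi h.
Proof.
move=> [qi qU].
have img_mono := kernel_monic (kerP (coker g)).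
have imgi_mono := kernel_monic (kerP (coker (g \oc i))).
have [e [eE e_epi]] := image_factor g.
have [e' [e'E e'_epi]] := image_factor (g \oc i).
have [|v [vE _]] := (kerP (coker g)).2 _ (im (g \oc i)).
  by apply: (epi_eq0 e'_epi); rewrite -mcompA e'E mcompA (cokerP g).1 mcomp0l.
have v_mono : monic v by apply: (@monic_compr _ _ _ _ (im g)); rewrite vE.
have vK : is_kernel (coker (g \oc i) \oc im g) v.
  split=> [|T x]; first by rewrite -mcompA vE (kerP (coker _)).1.
  rewrite -mcompA => /(kerP (coker _)).2[y [yE _]]; exists y; split.
    by apply: img_mono; rewrite mcompA vE yE.
  by move=> z vz; apply: imgi_mono; rewrite yE -vz mcompA vE.
have [|h [hE _]] := qU _ (coker v \oc e).
  rewrite -mcompA; have -> : e \oc i = v \oc e'.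
    by apply: img_mono; rewrite !mcompA vE eE e'E.
  by rewrite mcompA (cokerP v).1 mcomp0l.
exists (Coker v), v, (coker v), h; split.
  by split; [exact: kernel_of_cokernel vK (cokerP v) | exact: cokerP].
apply: (@epi_compr _ _ _ _ _ q); rewrite hE.
exact: epi_comp (cokernel_epi (cokerP v)) e_epi.
Qed.

(** Embeds the graded pieces of the pullback filtration in those of N: v is the kernel of
    [q \oc pb2 j h], whose coimage maps monically to G. *)
Lemma pb_comp_subobject B X Y Z W G (j : hom X Z) (h : hom Y Z) (i : hom B Y)
    (w : hom Y W) (q : hom Y G) :
  is_kernel w i -> is_cokernel i q ->
  exists (S : A) (v : hom (Pb j (h \oc i)) (Pb j h)) (c : hom (Pb j h) S)
         (m : hom S G), short_exact v c /\ monic m.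
Proof.
move=> iK qC; have [qi iU] := kernel_of_cokernel iK qC.
have i_mono := kernel_monic iK.
have [pE pU] := PbP j (h \oc i); have [rE rU] := PbP j h.
have [|v [[v1 v2] _]] := rU _ (pb1 j (h \oc i)) (i \oc pb2 j (h \oc i)).
  by rewrite mcompA.
have vK : is_kernel (q \oc pb2 j h) v.
  split=> [|T x]; first by rewrite -mcompA v2 mcompA qi mcomp0l.
  rewrite -mcompA => /iU[y [yE _]].
  have [|z [[z1 z2] _]] := pU _ (pb1 j h \oc x) y.
    by rewrite -mcompA yE mcompA rE mcompA.
  exists z; split.
    by apply: pb_joint; rewrite mcompA ?v1 ?v2 // -mcompA z2 yE.
  move=> t vt; apply: pb_joint; first by rewrite z1 -vt mcompA v1.
  by apply: i_mono; rewrite z2 yE -vt [LHS]mcompA v2 -[LHS]mcompA.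
have [m [mE _]] := (cokerP v).2 _ _ vK.1.
exists (Coker v), v, (coker v), m; split.
  by split; [exact: kernel_of_cokernel vK (cokerP v) | exact: cokerP].
exact: coimage_monic vK (cokerP v) mE.
Qed.

(** C is the quotient K / Im f. If it vanishes, u is epi, and e is u after the epi from X to Im
    f. *)
Lemma im_in_kernel X Y K W (f : hom X Y) (w : hom Y W) (k : hom K Y)
    (e : hom X K) :
  is_kernel w k -> k \oc e = f ->
  exists (C : A) (u : hom (Im f) K) (c : hom K C),
    short_exact u c /\ (is_zero C -> epi e).
Proof.
move=> kK kef; have [u ku] := im_kernel kK kef.
have k_mono := kernel_monic kK.
have im_mono := kernel_monic (kerP (coker f)).
have [e1 [e1E e1_epi]] := image_factor f.
have uK : is_kernel (coker f \oc k) u.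
  split=> [|T x]; first by rewrite -mcompA ku (kerP (coker f)).1.
  rewrite -mcompA => /(kerP (coker f)).2[y [yE _]]; exists y; split.
    by apply: k_mono; rewrite mcompA ku yE.
  by move=> z uz; apply: im_mono; rewrite yE -uz mcompA ku.
exists (Coker u), u, (coker u); split.
  by split; [exact: kernel_of_cokernel uK (cokerP u) | exact: cokerP].
move=> /coker_zero_epi u_epi; suff <- : u \oc e1 = e by exact: epi_comp.
by apply: k_mono; rewrite mcompA ku e1E kef.
Qed.

(** Exhibits an intersection of strict subobjects as a kernel, so that [im_kernel_iso] applies to
    it. *)
Lemma cap_kernel X P Q W1 W2 (a : hom P X) (b : hom Q X) (w1 : hom X W1)
    (w2 : hom X W2) :
  is_kernel w1 a -> is_kernel w2 b ->
  is_kernel (in1 \oc w1 + in2 \oc w2) (cap a b).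
Proof.
move=> aK bK; have [p1i1 p2i2 p1i2 p2i1 ipE] := bipP W1 W2.
have [pE pU] := PbP a b.
have bE : b \oc pb2 a b = cap a b by rewrite -pE.
split=> [|T x wx].
  rewrite mcompDl -!mcompA -[in X in _ + X]bE /cap.
  by rewrite !(mcompA w1) !(mcompA w2) aK.1 bK.1 !mcomp0l !mcomp0r addr0.
have w1x : w1 \oc x = 0.
  have := congr1 (mcomp pr1) wx.
  by rewrite mcompA mcompDr !mcompA p1i1 p1i2 mcomp1m mcomp0l addr0 mcomp0r.
have w2x : w2 \oc x = 0.
  have := congr1 (mcomp pr2) wx.
  by rewrite mcompA mcompDr !mcompA p2i1 p2i2 mcomp1m mcomp0l add0r mcomp0r.
have [y [ay _]] := aK.2 _ _ w1x; have [z [bz _]] := bK.2 _ _ w2x.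
have [|u [[u1 u2] _]] := pU _ y z; first by rewrite ay bz.
exists u; split; first by rewrite /cap -mcompA u1.
move=> v vE; apply: pb_joint.
  by apply: (kernel_monic aK); rewrite u1 ay -vE mcompA.
by apply: (kernel_monic bK); rewrite u2 bz -vE -bE mcompA.
Qed.

(* [Pb f h -> Pb j h] is a cokernel, being a pullback of the coimage [p]; hence
   a map out of [Pb f h] that kills [Ker f] descends to [Pb j h]. *)
Lemma sum_to_preimage_epi X Y Z B C (f : hom X Y) (h : hom Z Y) (p : hom X C)
    (j : hom C Y) (i : hom B X) (e : hom B (Pb j h))
    (s : hom (bip B (Ker f)) (Pb f h)) W (w : hom Y W) :
  is_kernel w h -> is_cokernel (ker f) p -> j \oc p = f -> epi e ->
  pb1 j h \oc e = p \oc i -> pb1 f h \oc s = sum_map i (ker f) -> epi s.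
Proof.
move=> hK pC jf e_epi e1 sE; have [p1i1 p2i2 p1i2 p2i1 ipE] := bipP B (Ker f).
have [fE fU] := PbP f h; have [jE jU] := PbP j h.
have t_mono := kernel_monic (kernel_pullback hK (PbP f h)).
have t'_mono := kernel_monic (kernel_pullback hK (PbP j h)).
have [|t [[t1 t2] _]] := jU _ (p \oc pb1 f h) (pb2 f h).
  by rewrite mcompA jf.
have tP : is_pullback p (pb1 j h) (pb1 f h) t.
  split=> [|T a b ab]; first by rewrite t1.
  have [|u [[u1 u2] uU]] := fU _ a (pb2 j h \oc b).
    by rewrite -jf -mcompA ab mcompA jE mcompA.
  exists u; split; last by move=> v [v1 v2]; apply: t_mono; rewrite u1 v1.
  by split=> //; apply: t'_mono; rewrite mcompA t1 -mcompA u1.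
have [V [v vC]] := A_qa.2 _ _ _ _ _ _ _ _ _ _ pC tP.
have s1 : pb1 f h \oc (s \oc in1) = i.
  rewrite mcompA sE /sum_map mcompDl -!mcompA p1i1 p2i1.
  by rewrite mcompm1 mcomp0r addr0.
have s2 : pb1 f h \oc (s \oc in2) = ker f.
  rewrite mcompA sE /sum_map mcompDl -!mcompA p1i2 p2i2.
  by rewrite mcompm1 mcomp0r add0r.
apply: epi0 => T g gs.
have [|g' [g'E _]] := vC.2 _ g.
  have [|y [yE _]] := (kerP f).2 _ (pb1 f h \oc v).
    have -> : f \oc (pb1 f h \oc v) = j \oc p \oc (pb1 f h \oc v) by rewrite jf.
    by rewrite -mcompA (mcompA p) -t1 -mcompA vC.1 !mcomp0r.
  have -> : v = s \oc in2 \oc y by apply: t_mono; rewrite [RHS]mcompA s2.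
  by rewrite !mcompA gs !mcomp0l.
have te : t \oc (s \oc in1) = e.
  by apply: t'_mono; rewrite mcompA t1 -mcompA s1.
suff g'0 : g' = 0 by rewrite -g'E g'0 mcomp0l.
apply: (epi_eq0 e_epi).
by rewrite -te mcompA g'E mcompA gs mcomp0l.
Qed.

End QuasiAbelian.

(** * An additive measure of the deviation of the slope from a given value *)

Section Defect.
Variables (L : udivOrderedZmodType) (A : preabelian).
Variables (rk : rank_function A) (deg : degree_function A L).
Implicit Types (X Y Z : A) (l : L).

Lemma short_exact_zero Z : is_zero Z -> short_exact (idm Z) (idm Z).
Proof.
move=> Z0; split; split=> [|T g _]; try exact: zero_in.
  by exists 0; split=> [|h _]; exact: zero_in.
by exists 0; split=> [|h _]; exact: zero_out.
Qed.

Lemma rk_zero Z : is_zero Z -> rk Z = 0%N.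
Proof.
move=> /short_exact_zero/(rk_add rk)/eqP.
by rewrite -[X in X == _]addn0 eqn_add2l => /eqP.
Qed.

Lemma deg_zero Z : is_zero Z -> deg Z = 0.
Proof.
move=> /short_exact_zero/(deg_add deg) degZ.
by apply: (addrI (deg Z)); rewrite addr0.
Qed.

Lemma rk_eq0 X : rk X = 0%N -> is_zero X.
Proof.
(* Equality in the group of endomorphisms is decidable, and X is zero exactly when its identity is
   0; this decides whether X is zero. *)
move=> rk0; case: (eqVneq (idm X) 0) => [/idm0_is_zero // | X_neq0].
case: (@rk_neq0 _ rk X) => // X0.
by rewrite is_zero_idm ?eqxx in X_neq0.
Qed.

(** On nonzero X this is rk(X) (l - slope(X)). Its sign compares the slope with l, and unlike the
    slope it is additive and meaningful on zero objects. *)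
Definition defect l X : L := l *+ rk X - deg X.

Lemma defect_add l X Y Z (f : hom X Y) (g : hom Y Z) :
  short_exact f g -> defect l Y = defect l X + defect l Z.
Proof.
move=> fg; rewrite /defect (rk_add rk fg) (deg_add deg fg) mulrnDr opprD.
exact: addrACA.
Qed.

Lemma defect_zero l Z : is_zero Z -> defect l Z = 0.
Proof. by move=> Z0; rewrite /defect rk_zero // deg_zero // subr0. Qed.

Lemma defect_iso l X Y : isomorphic X Y -> defect l X = defect l Y.
Proof. by move=> XY; rewrite /defect (rk_iso rk XY) (deg_iso deg XY). Qed.

Lemma slopeK X : ~ is_zero X -> slope rk deg X *+ rk X = deg X.
Proof.
by move=> X_neq0; rewrite ndivK // lt0n; apply/eqP; exact: rk_neq0.
Qed.

Lemma defect_ge0 l X :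
  (~ is_zero X -> slope rk deg X <= l) -> 0 <= defect l X.
Proof.
move=> Xl.
case: (eqVneq (idm X) 0) => [/idm0_is_zero/(defect_zero l)-> // | X0].
have Xn : ~ is_zero X by move/is_zero_idm/eqP; rewrite (negPf X0).
by rewrite /defect -(slopeK Xn) ud_subr_ge0 ud_lerMn // Xl.
Qed.

Lemma defect_le0 l X :
  (~ is_zero X -> l <= slope rk deg X) -> defect l X <= 0.
Proof.
move=> Xl.
case: (eqVneq (idm X) 0) => [/idm0_is_zero/(defect_zero l)-> // | X0].
have Xn : ~ is_zero X by move/is_zero_idm/eqP; rewrite (negPf X0).
rewrite -ud_subr_ge0 sub0r opprB -(slopeK Xn) ud_subr_ge0.
exact/ud_lerMn/Xl.
Qed.

End Defect.

(** * Graded pieces as cokernels of transition maps, and lists containing the breaks *)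

Section Filtrations.
Variables (L : udivOrderedZmodType) (A : preabelian).
Implicit Types (M N : filtration L A) (l a b x : L) (s : seq L).

(** A cokernel depends only on which maps annihilate it from the left: k may replace the map from
    the colimit W_{<l} M if the maps killing k are those killing all earlier steps. *)
Lemma gr_cokernel M l B (k : hom B (M l)) :
  (forall T (g : hom (M l) T), g \oc k = 0 <->
     forall x (h : x < l), g \oc fmap M (ltW h) = 0) ->
  exists (G : A) (q : hom (M l) G), is_gr M l G /\ is_cokernel k q.
Proof.
move=> kP; have [G GM] := gr_ex M l; exists G.
have [D [c [i [q [cC ic [qi qU]]]]]] := GM.
exists q; split=> //; split.
  apply/kP => x h; have icx : i \oc c (Sub x h) = fmap M (ltW h).
    exact: etrans (ic _) (congr1 (fmap M (y:=l)) (bool_irrelevance _ _)).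
  by rewrite -icx mcompA qi mcomp0l.
move=> T g /kP g0; apply: qU.
(* Both g i and 0 induce the zero cocone, so they agree by uniqueness in the colimit. *)
have [|u [_ uU]] := cC.2 T (fun=> 0); first by move=> x y h; rewrite mcomp0l.
rewrite -(uU (g \oc i)) => [|x]; first by apply: uU => x; rewrite mcomp0l.
by rewrite -mcompA ic g0.
Qed.

Lemma fmap_kernel M a b (h : a <= b) :
  is_kernel (coker (inc M a) \oc inc M b) (fmap M h).
Proof.
have [iE iU] := strict_monic_kernel (inc_strict M a).
split=> [|T g]; first by rewrite -mcompA inc_fmap.
rewrite -mcompA => /iU[y [yE _]]; exists y; split.
  by apply: (@inc_monic _ _ M b); rewrite mcompA inc_fmap.
by move=> z zE; apply: (@inc_monic _ _ M a); rewrite yE -zE mcompA inc_fmap.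
Qed.

(** With no jump from a up to l, excluding l itself, W_{<l} M is W_{<=a} M. *)
Lemma gr_cokernel_fmap M a l (al : a < l) :
  (forall x (h : a <= x), x < l -> iso (fmap M h)) ->
  exists (G : A) (q : hom (M l) G),
    is_gr M l G /\ is_cokernel (fmap M (ltW al)) q.
Proof.
move=> aI; apply: gr_cokernel => T g; split=> [g0 x h | -> //].
have /orP[xa | ax] := ud_total x a.
  by rewrite (fmap_comp M xa (ltW al)) mcompA g0 mcomp0l.
apply: (epi_eq0 (iso_epi (aI x ax h))).
by rewrite -mcompA -(fmap_comp M ax (ltW h) (ltW al)).
Qed.

Lemma gr_cokernel_zero M l B :
  (forall x, x < l -> is_zero (M x)) ->
  exists (G : A) (q : hom (M l) G),
    is_gr M l G /\ is_cokernel (0 : hom B (M l)) q.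
Proof.
move=> M0; apply: gr_cokernel => T g; split=> [_ x h | _].
  by apply: zero_out; exact: M0.
by rewrite mcomp0r.
Qed.

(* Unlike [is_breaks], this is monotone in [s], so that several filtrations
   admit a common [s]. *)
Definition breaks_in M s :=
  [/\ forall a x (h : a <= x), (forall b, b \in s -> b <= x -> b <= a) ->
        iso (fmap M h),
      forall x, (forall b, b \in s -> ~~ (b <= x)) -> is_zero (M x)
    & forall x, (forall b, b \in s -> b <= x) -> iso (inc M x)].

Lemma breaks_in_sub M s t : {subset s <= t} -> breaks_in M s -> breaks_in M t.
Proof.
move=> st [s1 s2 s3]; split.
- by move=> a x h tax; apply: s1 => b /st; exact: tax.
- by move=> x tx; apply: s2 => b /st; exact: tx.
- by move=> x tx; apply: s3 => b /st; exact: tx.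
Qed.

Lemma iso_zero (X Y : A) (f : hom X Y) : is_zero X -> is_zero Y -> iso f.
Proof. by move=> X0 Y0; exists 0; split; exact: zero_in. Qed.

Lemma breaks_in_ex M : exists s, breaks_in M s.
Proof.
have [s [s_sort s0 s1 s2 s3]] := fil_finite M; exists s.
case: s => [|b0 s] in s_sort s0 s1 s2 s3 *.
  have t0 := s0.1 erefl.
  have M0 x : is_zero (M x).
    by apply/idm0_is_zero/(@inc_monic _ _ M x); exact: zero_in.
  by split=> *; rewrite ?M0 //; exact: iso_zero.
have nn : b0 :: s <> [::] by [].
have M0 x : ~~ (b0 <= x) -> is_zero (M x) by move=> /ud_ltNge; exact: s1.
split=> [a x ax sax | x sx | x sx].
(* If a lies below the first break, so does x, and both steps are zero. *)
- case: (boolP (b0 <= a)) => [b0a | b0a]; last first.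
    apply: iso_zero; apply: M0 => //; apply: contra b0a => /sax.
    by rewrite mem_head; apply.
  have exi : exists i, (i < size (b0 :: s))%N && ((b0 :: s)`_i <= a).
    by exists 0%N.
  have ubi i : (i < size (b0 :: s))%N && ((b0 :: s)`_i <= a) -> (i <= size s)%N.
    by case/andP.
  (* The index i is that of the last break at most a. If another break follows, it exceeds x, and
     the maps from step i to a and to x are both isomorphisms; otherwise the inclusions of both
     steps in the total object are. *)
  case: (ex_maxnP exi ubi) => i /andP[i_s ia] imax.
  case: (ltnP i.+1 (size (b0 :: s))) => [i1s | si1].
    have x_lt : x < (b0 :: s)`_i.+1.
      apply: ud_ltNge; apply/negP => /(sax _ (mem_nth 0 i1s)) i1a.
      by have := imax i.+1; rewrite i1s i1a ltnn => /(_ isT).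
    apply: (@iso_cancelr _ _ _ _ _ (fmap M ia)).
      by apply: s2 => //; exact: le_lt_trans x_lt.
    by rewrite -(fmap_comp M ia ax (le_trans ia ax)); exact: s2.
  have iE : (b0 :: s)`_i = last 0 (b0 :: s).
    have -> : i = size s by apply/eqP; rewrite eqn_leq -ltnS i_s.
    exact: (nth_last 0 (b0 :: s)).
  apply: (@iso_cancell _ _ _ _ (inc M x)).
    by apply: s3 => //; rewrite -iE (le_trans ia).
  by rewrite inc_fmap; apply: s3 => //; rewrite -iE.
- by apply/M0/sx; rewrite mem_head.
- by apply: s3 => //; apply: sx; exact: (mem_last b0 s).
Qed.

End Filtrations.

(** * Comparison of the image and pullback filtrations on one object *)

Section Comparison.
Variables (L : udivOrderedZmodType) (A : preabelian).
Hypothesis A_qa : quasi_abelian A.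
Variables (rk : rank_function A) (deg : degree_function A L).
Variables (M N : filtration L A) (f : filtration_hom M N).
Hypothesis M_udq : udq rk deg M.
Hypothesis N_uds : uds rk deg N.
Variables (X : A) (p : hom (tot M) X) (j : hom X (tot N)).
Hypothesis p_epi : epi p.
Hypothesis j_mono : monic j.
Hypothesis jp : j \oc p = ftot f.

Let P l : A := Im (p \oc inc M l).
Let Q l : A := Pb j (inc N l).

Lemma pb_inc_kernel l : is_kernel (coker (inc N l) \oc j) (pb1 j (inc N l)).
Proof.
exact: kernel_pullback (strict_monic_kernel (inc_strict N l)) (PbP _ _).
Qed.

Lemma to_pb_ex l : exists e : hom (M l) (Q l),
  pb1 j (inc N l) \oc e = p \oc inc M l /\ pb2 j (inc N l) \oc e = f l.
Proof.
have [_ U] := PbP j (inc N l).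
have [|e [[e1 e2] _]] := U _ (p \oc inc M l) (f l); last by exists e.
by rewrite mcompA jp ftot_inc.
Qed.

Lemma image_defect_le l B (k : hom B (M l)) G (q : hom (M l) G) :
  is_gr M l G -> is_cokernel k q ->
  defect rk deg l (P l) <= defect rk deg l (Im (p \oc inc M l \oc k)).
Proof.
move=> GM qC; have [S [v [c [h [vc h_epi]]]]] :=
  im_comp_quotient A_qa (p \oc inc M l) qC.
rewrite (defect_add _ _ l vc) -[leRHS]addr0 ud_lerD2l //.
by apply: defect_le0 => S_neq0; exact: M_udq GM _ _ h_epi S_neq0.
Qed.

Lemma pullback_defect_ge l B (k : hom B (N l)) W (w : hom (N l) W) G
    (q : hom (N l) G) :
  is_gr N l G -> is_kernel w k -> is_cokernel k q ->
  defect rk deg l (Pb j (inc N l \oc k)) <= defect rk deg l (Q l).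
Proof.
move=> GN kK qC.
have [S [v [c [m [vc m_mono]]]]] := pb_comp_subobject A_qa j (inc N l) kK qC.
rewrite (defect_add _ _ l vc) -[leLHS]addr0 ud_lerD2l //.
by apply: defect_ge0 => S_neq0; exact: N_uds GN _ _ m_mono S_neq0.
Qed.

(** The difference of ranks is the rank of Q_l / P_l, and only zero objects have rank 0. *)
Lemma rank_le_and_epi l (e : hom (M l) (Q l)) :
  pb1 j (inc N l) \oc e = p \oc inc M l ->
  (rk (P l) <= rk (Q l))%N /\ ((rk (Q l) - rk (P l))%N = 0%N -> epi e).
Proof.
move=> eE; have [C [u [c [uc C0]]]] := im_in_kernel A_qa (pb_inc_kernel l) eE.
rewrite (rk_add rk uc) leq_addr addKn; split=> // rk0.
exact/C0/(rk_eq0 rk0).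
Qed.

(** When both steps are total, P_l and Q_l are all of X. *)
Lemma isomorphic_top l :
  iso (inc M l) -> iso (inc N l) -> isomorphic (P l) (Q l).
Proof.
move=> /iso_epi incM [w [wi iw]]; have [e [e1 _]] := to_pb_ex l.
have pb1_mono := kernel_monic (pb_inc_kernel l).
(* The map v, with components [idm X] and [w \oc j], is inverse to the projection of Q_l to X. *)
have [|v [[v1 _] _]] := (PbP j (inc N l)).2 _ (idm X) (w \oc j).
  by rewrite mcompm1 mcompA iw mcomp1m.
have v_epi : epi v.
  apply: (@epi_compr _ _ _ _ _ (pb1 j (inc N l))).
  suff -> : v \oc pb1 j (inc N l) = idm _ by move=> T g h; rewrite !mcompm1.
  by apply: pb1_mono; rewrite mcompA v1 mcomp1m mcompm1.
have e_epi : epi e.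
  suff -> : e = v \oc (p \oc inc M l) by apply: epi_comp => //; exact: epi_comp.
  by apply: pb1_mono; rewrite e1 [RHS]mcompA v1 mcomp1m.
have [u [_ u_iso]] := im_kernel_iso (pb_inc_kernel l) e1 e_epi.
by exists u.
Qed.

(** By [rank_le_and_epi] it is enough that the rank of Q_l / P_l vanishes, which [path_defect_eq0]
    yields along a common list of breaks. *)
Lemma to_pb_epi l (e : hom (M l) (Q l)) :
  pb1 j (inc N l) \oc e = p \oc inc M l -> epi e.
Proof.
move=> eE; apply: (rank_le_and_epi eE).2.
have rkPQ x : (rk (P x) <= rk (Q x))%N.
  by have [e' [e'E _]] := to_pb_ex x; exact: (rank_le_and_epi e'E).1.
have [sM sMP] := breaks_in_ex M; have [sN sNP] := breaks_in_ex N.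
(* The value l is inserted among the breaks so that the conclusion can be read off at l itself. *)
pose s := sort <=%R (undup (l :: sM ++ sN)).
have s_mem x : (x \in s) = (x \in l :: sM ++ sN) by rewrite mem_sort mem_undup.
have l_s : l \in s by rewrite s_mem mem_head.
have s_sort : sorted <%R s.
  rewrite lt_sorted_uniq_le sort_uniq undup_uniq sort_sorted //.
  exact: ud_total.
have [M1 M2 M3] : breaks_in M s.
  by apply: breaks_in_sub sMP => x xs; rewrite s_mem inE mem_cat xs orbT.
have [N1 N2 N3] : breaks_in N s.
  by apply: breaks_in_sub sNP => x xs; rewrite s_mem inE mem_cat xs !orbT.
clearbody s; case: s => // a s in s_mem l_s s_sort M1 M2 M3 N1 N2 N3 *.
pose R x := (rk (Q x) - rk (P x))%N.
(* [D x x] is the quantity [E_x] of the header. *)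
pose D b x := defect rk deg b (Q x) - defect rk deg b (P x).
(* Changing the weight from a' to b changes the defect of Q_x / P_x by (b - a') times its rank. *)
have DE a' b x : D b x = D a' x + (b - a') *+ R x.
  have telescope (u v w : L) : (u - w) + (v - u) = v - w.
    by rewrite addrC addrA subrK.
  rewrite /D /defect /R mulrnBr // !mulrnBl [RHS]addrACA -opprD.
  by rewrite !telescope.
have lastP x : x \in a :: s -> x <= last a s.
  case/(nthP a) => i i_s <-; rewrite (last_nth a).
  by rewrite (lt_sorted_leq_nth a s_sort) ?inE.

have headP b x : x < a -> b \in a :: s -> ~~ (b <= x).
  move=> xa; rewrite inE => /orP[/eqP-> | bs]; apply/negP => bx.
    by have := lt_le_trans xa bx; rewrite ltxx.
  have ab : a < b by have /allP := order_path_min lt_trans s_sort; apply.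
  by have := lt_trans xa (lt_le_trans ab bx); rewrite ltxx.
have topI : isomorphic (P (last a s)) (Q (last a s)).
  by apply: isomorphic_top; [apply: M3 | apply: N3] => b /lastP.
apply: (@path_defect_eq0 _ (fun x => D x x) R a s) l_s.
(* By [DE] the left side is D y x. The graded pieces at y show that, at weight y, passing from x to
   y does not raise the defect of P and does not lower that of Q. *)
- apply: path_consecutive => // x y xs ys xy consec /=.
  rewrite xy /= -DE.
  have [|GM [qM [GMP qMC]]] := @gr_cokernel_fmap _ _ M x y xy.
    move=> z xz zy; apply: M1 => b bs bz; apply: consec => //.
    exact: le_lt_trans zy.
  have [|GN [qN [GNP qNC]]] := @gr_cokernel_fmap _ _ N x y xy.
    move=> z xz zy; apply: N1 => b bs bz; apply: consec => //.
    exact: le_lt_trans zy.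
  have := image_defect_le GMP qMC; rewrite -mcompA inc_fmap => defP.
  have := pullback_defect_ge GNP (fmap_kernel N (ltW xy)) qNC.
  rewrite inc_fmap => defQ.
  apply: ud_lerD => //.
  by rewrite -ud_subr_ge0 opprK addrC ud_subr_ge0.
(* Before the first break all steps vanish, so the graded pieces at a are compared with the image
   and the pullback of a zero map, both zero objects. Hence the defect at weight a is at most 0 on
   P_a and at least 0 on Q_a. *)
- have M0 x : x < a -> is_zero (M x).
    by move=> xa; apply: M2 => b; exact: headP.
  have N0 x : x < a -> is_zero (N x).
    by move=> xa; apply: N2 => b; exact: headP.
  have [Z Z0] := zero_ex A.
  have [GM [qM [GMP qMC]]] := @gr_cokernel_zero _ _ M a Z M0.
  have [GN [qN [GNP qNC]]] := @gr_cokernel_zero _ _ N a Z N0.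
  have zK : is_kernel (idm (N a)) (0 : hom Z (N a)).
    split=> [|T g]; first by rewrite mcomp0r.
    rewrite mcomp1m => ->; exists 0; split=> [|h _]; first by rewrite mcomp0r.
    exact: zero_in.
  have := image_defect_le GMP qMC.
  rewrite mcomp0r (defect_zero _ _ _ (im0_is_zero _ _)) => defP.
  have := pullback_defect_ge GNP zK qNC.
  rewrite mcomp0r (defect_zero _ _ _ (pb0_is_zero j_mono Z0)) => defQ.
  by rewrite ud_subr_ge0 (le_trans defP).
- by rewrite /D (defect_iso _ _ _ topI) subrr.
- by rewrite /R (rk_iso rk topI) subnn.
Qed.

End Comparison.

(** * Strict compatibility and co-compatibility, from the image and the coimage *)

Theorem proposition3p1p7 (L : udivOrderedZmodType) (A : preabelian)
    (A_qa : quasi_abelian A) (rk : rank_function A)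
    (deg : degree_function A L) (mu_slope : is_slope_function rk deg)
    (M N : filtration L A) (f : filtration_hom M N)
    (M_udq : udq rk deg M) (N_uds : uds rk deg N) :
  strictly_compatible f /\ strictly_cocompatible f.
Proof.
split=> l.
  have [p [pE p_epi]] := image_factor A_qa (ftot f).
  have j_mono := kernel_monic (kerP (coker (ftot f))).
  have [e [e1 _]] := to_pb_ex pE l.
  have e_epi := to_pb_epi A_qa M_udq N_uds p_epi j_mono pE e1.
  (* For X = Im f, Q_l is the intersection of f(M) with W_{<=l} N, and the epi e identifies the
     image of W_{<=l} M with it. *)
  apply: (im_kernel_iso (cap_kernel (kerP (coker (ftot f))) _) _ e_epi).
    exact: strict_monic_kernel (inc_strict N l).
  by rewrite /cap -mcompA e1 mcompA pE.
have [j [jE j_mono]] := coimage_factor A_qa (ftot f).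
have p_epi := cokernel_epi (cokerP (ker (ftot f))).
have [e [e1 _]] := to_pb_ex jE l.
have e_epi := to_pb_epi A_qa M_udq N_uds p_epi j_mono jE e1.
have incK := strict_monic_kernel (inc_strict N l).
have tK := kernel_pullback incK (PbP (ftot f) (inc N l)).
have [_ tU] := PbP (ftot f) (inc N l).
(* The second component involves only the projection to W_{<=l} M, since f vanishes on Ker f. *)
have [|s [[s1 _] _]] := tU _ (sum_map (inc M l) (ker (ftot f))) (f l \oc pr1).
  rewrite /sum_map mcompDr !mcompA (kerP (ftot f)).1 mcomp0l addr0.
  by rewrite ftot_inc.
have s_epi := sum_to_preimage_epi A_qa incK (cokerP _) jE e_epi e1 s1.
(* As s is epi, u identifies W_{<=l} M + Ker f with the preimage of W_{<=l} N. Its inverse v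
   transports the inclusion b of Ker f, and the maps x and y induced by u and v on the quotients are
   mutually inverse. *)
have [u [uE [v [vu uv]]]] := im_kernel_iso tK s1 s_epi.
have [|b [[b1 _] _]] := tU _ (ker (ftot f)) 0.
  by rewrite (kerP (ftot f)).1 mcomp0r.
have [|x [xE _]] := (cokerP (v \oc b)).2 _ (coker b \oc u).
  by rewrite -mcompA (mcompA u) uv mcomp1m (cokerP b).1.
have [|y [yE _]] := (cokerP b).2 _ (coker (v \oc b) \oc v).
  by rewrite -mcompA (cokerP (v \oc b)).1.
exists (v \oc b), b, u, x; split=> //.
  by rewrite /subsum -uE -mcompA (mcompA u) uv mcomp1m.
exists y; split.
  apply: (cokernel_epi (cokerP (v \oc b))).
  by rewrite -mcompA xE mcompA yE -mcompA vu mcompm1 mcomp1m.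
apply: (cokernel_epi (cokerP b)).
by rewrite -mcompA yE mcompA xE -mcompA uv mcompm1 mcomp1m.
Qed.
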